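(* Let $G$ be a topological semigroup with identity acting continuously on a compact Hausdorff space $X$ by surjective continuous maps. Let $k\ge2$ and $(x_1,\dots,x_k)\in X^k\setminus\Delta_k(X)$. Then $(x_1,\dots,x_k)$ is a sequence entropy tuple if and only if it is an IN-tuple.
   Context: $\Delta_k(X)=\{(x,\dots,x)\}$. For $s\in G$ and $A\subseteq X$, $s^{-1}A=\{x\in X: sx\in A\}$. For a sequence $\mathfrak s=\{s_n\}_{n\in{\mathbb N}}$ in $G$ and a finite open cover ${\mathcal U}$ of $X$, ${\rm h}_{\rm top}(X,{\mathcal U};\mathfrak s)=\limsup_{n\to\infty}\frac1n\log N(\bigvee_{i=1}^n s_i^{-1}{\mathcal U})$, where $N(\cdot)$ is the minimal cardinality of a subcover. A tuple $(x_1,\dots,x_k)\in X^k\setminus\Delta_k(X)$ is a sequence entropy tuple if whenever $U_1,\dots,U_l$ are closed pairwise disjoint neighbourhoods of the distinct points in the list $x_1,\dots,x_k$, there is a sequence $\mathfrak s$ in $G$ with ${\rm h}_{\rm top}(X,\{U_1^{\rm c},\dots,U_l^{\rm c}\};\mathfrak s)>0$. For a tuple $(A_1,\dots,A_k)$ of subsets of $X$, $J\subseteq G$ is an independence set if for every nonempty finite $I\subseteq J$ and $\sigma:I\to\{1,\dots,k\}$, $\bigcap_{s\in I}s^{-1}A_{\sigma(s)}\neq\emptyset$. A tuple $(x_1,\dots,x_k)\in X^k$ is an IN-tuple if for every product neighbourhood $U_1\times\cdots\times U_k$ of it, $(U_1,\dots,U_k)$ has arbitrarily large finite independence sets. *)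

(* Defs.v *)
From HB Require Import structures.
From mathcomp Require Import all_boot all_order all_algebra.
From mathcomp Require Import all_classical all_reals all_analysis.
Set Implicit Arguments. Unset Strict Implicit. Unset Printing Implicit Defensive.
Import Order.TTheory GRing.Theory Num.Theory.
Local Open Scope classical_set_scope.
Local Open Scope ring_scope.

(* A finite cover of X is represented by a list of subsets of X. *)

Definition cover_preimage (X : Type) (f : X -> X) (U : seq (set X)) : seq (set X) :=
  [seq f @^-1` A | A <- U].

Definition cover_join (X : Type) (U V : seq (set X)) : seq (set X) :=
  [seq A `&` B | A <- U, B <- V].

Definition seq_join (G X : Type) (act : G -> X -> X) (s : nat -> G)
  (U : seq (set X)) (n : nat) : seq (set X) :=
  foldr (fun i V => cover_join (cover_preimage (act (s i)) U) V) [:: setT] (iota 1 n).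

Definition has_subcover_of_size (X : Type) (C : seq (set X)) (n : nat) : Prop :=
  exists idx : seq nat, size idx = n /\ all (fun i => i < size C)%N idx /\
    forall x : X, exists2 i, i \in idx & nth set0 C i x.

Definition Ncover (X : Type) (C : seq (set X)) : nat :=
  xget 0%N [set n | has_subcover_of_size C n /\
                    forall m, has_subcover_of_size C m -> (n <= m)%N].

Definition htop_seq (R : realType) (G X : Type) (act : G -> X -> X)
  (U : seq (set X)) (s : nat -> G) : \bar R :=
  limn_esup (fun n : nat => ((ln ((Ncover (seq_join act s U n))%:R : R)) / n%:R)%:E).

Definition off_diagonal (X : Type) (k : nat) (x : 'I_k -> X) : Prop :=
  ~ (forall i j, x i = x j).

Definition sequence_entropy_tuple (R : realType) (G : Type) (X : topologicalType)
  (act : G -> X -> X) (k : nat) (x : 'I_k -> X) : Prop :=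
  off_diagonal x /\
  forall (l : nat) (y : 'I_l -> X), injective y -> range y = range x ->
  forall U : 'I_l -> set X,
    (forall j, closed (U j) /\ nbhs (y j) (U j)) ->
    (forall i j, i != j -> U i `&` U j = set0) ->
    exists s : nat -> G,
      (0 < htop_seq R act [seq ~` U j | j <- enum 'I_l] s)%E.

Definition independence_set (G X : Type) (act : G -> X -> X) (k : nat)
  (A : 'I_k -> set X) (J : set G) : Prop :=
  forall I : set G, finite_set I -> I !=set0 -> I `<=` J ->
  forall sigma : G -> 'I_k,
    exists x : X, forall s, I s -> A (sigma s) (act s x).

Definition arb_large_independence (G X : Type) (act : G -> X -> X) (k : nat)
  (A : 'I_k -> set X) : Prop :=
  forall n : nat, exists J : set G,
    finite_set J /\ independence_set act A J /\
    exists f : 'I_n -> G, injective f /\ range f `<=` J.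

Definition IN_tuple (G : Type) (X : topologicalType) (act : G -> X -> X)
  (k : nat) (x : 'I_k -> X) : Prop :=
  forall U : 'I_k -> set X, (forall i, nbhs (x i) (U i)) ->
    arb_large_independence act U.

(* Main.v *)
(* Let [U_1, ..., U_l] be disjoint closed neighbourhoods of the distinct points of
   the tuple.  If they have independence sets of size [p], any subfamily of the
   joined cover over such a set that covers [X] has at least [(l / (l - 1)) ^ p]
   members, and concatenating independence sets of sizes [1, 2, 4, ...] gives a
   sequence with positive entropy.  Conversely, a point [x] induces the partial
   colouring of [{1, ..., n}] that gives [i] the colour [j] when [s_i x] lies in
   [U_j].  If no set of more than [m] indices is shattered by these colourings,
   then at most [(n + 1) ^ m] sets are shattered, and a halving argument covers
   [X] by [(n + 1) ^ O(log n)] members of the joined cover, so that the entropy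
   along [s] vanishes. *)
Require Import Defs.
From HB Require Import structures.
From mathcomp Require Import all_boot all_order all_algebra.
From mathcomp Require Import all_classical all_reals all_analysis.
From mathcomp Require Import zify ring.
Set Implicit Arguments. Unset Strict Implicit. Unset Printing Implicit Defensive.
Import Order.TTheory GRing.Theory Num.Theory.
Local Open Scope classical_set_scope.
Local Open Scope nat_scope.

(** * Sets shattered by partial colourings *)

Section Shattering.
Variables (T : Type) (Z : finType) (l : nat) (P : Z -> 'I_l -> set T).
Hypothesis l_gt1 : 1 < l.
Hypothesis P_disj : forall z i j x, P z i x -> P z j x -> i = j.

(** [P z i x] says that [x] gives [z] the colour [i], so a point is a partial colouring of [Z]. The
    empty set is shattered exactly when [S] is nonempty. *)
Definition shatters (S : set T) (J : {set Z}) : bool :=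
  `[< forall sigma : Z -> 'I_l,
        exists2 x, S x & forall z, z \in J -> P z (sigma z) x >].

Definition nshattered (S : set T) : nat := #|[pred J | shatters S J]|.

Let i0 : 'I_l := Ordinal (ltnW l_gt1).

(** Every point of the slice gives [z] the colour [i], so no second colour is realised at [z]. *)
Lemma shatters_slice_notin S z i (J : {set Z}) :
  shatters (S `&` P z i) J -> z \notin J.
Proof.
move=> /asboolP sh; apply/negP => zJ.
have [j ij] : exists j : 'I_l, j != i.
  case: (eqVneq i i0) => [->|ne]; last by exists i0; rewrite eq_sym.
  by exists (Ordinal l_gt1).
have [x [_ Px] /(_ z zJ) Pj] := sh (fun=> j).
by move: ij; rewrite (P_disj Px Pj) eqxx.
Qed.

Lemma shatters_slice S z i J : shatters (S `&` P z i) J -> shatters S J.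
Proof.
by move=> /asboolP sh; apply/asboolP => s; have [x [Sx _] ?] := sh s; exists x.
Qed.

Lemma shatters_setU1 S z J :
  (forall i, shatters (S `&` P z i) J) -> shatters S (z |: J).
Proof.
move=> sh; apply/asboolP => s; have /asboolP/(_ s)[x [Sx Pzx] PJ] := sh (s z).
by exists x => // w; rewrite in_setU1 => /predU1P[->|/PJ].
Qed.

(** A set shattered by some slice is shattered by [S]; one shattered by every slice yields the
    further set [z |: J]. Nothing is counted twice, since sets shattered by a slice omit [z]. *)
Lemma nshattered_slices S z :
  #|[pred J | [exists i, shatters (S `&` P z i) J]]| +
  #|[pred J | [forall i, shatters (S `&` P z i) J]]| <= nshattered S.
Proof.
set A := [pred J | _]; set B := [pred J | _].
have B_notin J : J \in B -> z \notin J.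
  by move=> /forallP/(_ i0); exact: shatters_slice_notin.
have <- : #|[seq z |: J | J in B]| = #|B|.
  apply: card_in_image => J1 J2 /B_notin z1 /B_notin z2 eqJ.
  by rewrite -(finset.setU1K z1) -(finset.setU1K z2) eqJ.
rewrite -cardUI [X in _ + X]eq_card0 ?addn0.
  apply/subset_leq_card/fintype.subsetP => J; rewrite !ssrbool.inE => /orP[/existsP[i]|].
    exact: shatters_slice.
  by move=> /fintype.imageP[K /forallP KB ->]; exact: shatters_setU1.
move=> J; apply/negP; rewrite !ssrbool.inE => /andP[/existsP[i /shatters_slice_notin zJ]].
by move=> /fintype.imageP[K _ JE]; rewrite JE setU11 in zJ.
Qed.

Lemma nshattered_slice_le S z :
  exists i, l * nshattered (S `&` P z i) <= l.-1 * nshattered S.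
Proof.
apply/not_existsP => lt_slice.
suff sum_le : \sum_(i < l) nshattered (S `&` P z i) <= l.-1 * nshattered S.
  have : \sum_(i < l) l.-1 * nshattered S < \sum_(i < l) l * nshattered (S `&` P z i).
    rewrite (bigD1 i0) //= [X in _ < X](bigD1 i0) //= -addSn leq_add //.
      by rewrite ltnNge; apply/negP/lt_slice.
    by apply: leq_sum => i _; apply/ltnW; rewrite ltnNge; apply/negP/lt_slice.
  rewrite sum_nat_const card_ord -big_distrr /= ltnNge => /negP; apply.
  by rewrite leq_mul2l sum_le orbT.
apply: (@leq_trans (l.-1 * #|[pred J | [exists i, shatters (S `&` P z i) J]]| +
  #|[pred J | [forall i, shatters (S `&` P z i) J]]|)); last first.
  apply: leq_trans (leq_mul (leqnn l.-1) (nshattered_slices S z)).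
  by rewrite mulnDr leq_add2l leq_pmull // -ltnS prednK // ltnW.
(* After exchanging the sums, [J] contributes the number of slices shattering it: at most [l - 1]
   unless all do, and then [l = (l - 1) + 1]. *)
rewrite /nshattered; under eq_bigr do rewrite -sum1_card big_mkcond /=.
rewrite exchange_big -!sum1_card big_distrr /= [X in _ <= X + _]big_mkcond.
rewrite [X in _ <= _ + X]big_mkcond -big_split /=; apply: leq_sum => J _.
rewrite -big_mkcond sum1_card /= !ssrbool.inE muln1.
case: ifPn => [_|/existsPn noJ]; last first.
  by rewrite eq_card0 // => i; rewrite !ssrbool.inE; exact/negbTE/noJ.
case: ifPn => [_|/forallPn[i iJ]].
  by rewrite (leq_trans (max_card _)) // card_ord addn1 prednK // ltnW.
rewrite addn0 -ltnS prednK; last exact: ltnW.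
by rewrite -[X in _ < X]card_ord proper_card //; apply/fintype.properP; split;
   [exact/fintype.subsetP | exists i; rewrite // !ssrbool.inE].
Qed.

(* Pick [g z] as in [nshattered_slice_le]: the points of [S] not avoided by [g]
   lie in one of the slices [S `&` P z (g z)], each of which shatters fewer sets by
   a factor [(l - 1) / l]. *)
Lemma avoiding_functions S t : nshattered S * l.-1 ^ t < l ^ t ->
  exists2 gs : seq {ffun Z -> 'I_l}, size gs <= #|Z|.+1 ^ t &
    forall x, S x -> exists2 g, g \in gs & forall z, ~ P z (g z) x.
Proof.
elim: t S => [|t IH] S.
  (* A nonempty [S] would shatter the empty set, so here [S] is empty. *)
  rewrite !expn0 muln1 ltnS leqn0 => /eqP S0; exists [::] => // x Sx.
  have := card0_eq S0 finset.set0; rewrite !ssrbool.inE => /negP[].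
  by apply/asboolP => s; exists x => // z; rewrite finset.in_set0.
move=> nS.
have /fin_all_exists[g gP] := nshattered_slice_le S.
have /fin_all_exists2[h size_h hP] z : exists2 gs : seq {ffun Z -> 'I_l},
    size gs <= #|Z|.+1 ^ t & forall x, (S `&` P z (g z)) x ->
    exists2 g, g \in gs & forall z, ~ P z (g z) x.
  apply: IH; rewrite -(ltn_pmul2l (ltnW l_gt1)) -expnS.
  apply: leq_ltn_trans nS; rewrite mulnA expnS mulnA [nshattered S * _]mulnC.
  by rewrite leq_mul2r gP orbT.
exists (finfun g :: flatten [seq h z | z <- enum Z]) => [/=|x Sx].
  rewrite size_flatten sumnE big_map big_map big_enum expnS mulSn.
  rewrite -add1n leq_add ?expn_gt0 //.
  by rewrite -sum_nat_const leq_sum.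
have [[z Pz]|noz] := pselect (exists z, P z (g z) x).
  have [g' g'h g'P] := hP z x (conj Sx Pz).
  exists g' => //; rewrite inE; apply/orP; right.
  by apply/flattenP; exists (h z) => //; apply: map_f; rewrite mem_enum.
exists (finfun g); first by rewrite mem_head.
by move=> z; rewrite ffunE => Pz; apply: noz; exists z.
Qed.

(** A set of at most [m] elements is listed by a map from ['I_m] to [option Z], with [None] as
    padding. *)
Lemma nshattered_le S m :
  (forall J, shatters S J -> #|J| <= m) -> nshattered S <= #|Z|.+1 ^ m.
Proof.
move=> shm.
pose F (h : {ffun 'I_m -> option Z}) : {set Z} := finset (fun z => Some z \in codom h).
have <- : #|{ffun 'I_m -> option Z}| = #|Z|.+1 ^ m.
  by rewrite card_ffun card_ord card_option.
apply: leq_trans (leq_image_card F _); apply/subset_leq_card/fintype.subsetP => J.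
rewrite !ssrbool.inE => /shm Jm; apply/fintype.imageP.
exists [ffun i : 'I_m => nth None (map Some (enum J)) i] => //.
apply/finset.setP => z; rewrite inE; apply/idP/codomP => [zJ|[i]].
  have idx : index z (enum J) < size (enum J) by rewrite index_mem mem_enum.
  have idm : index z (enum J) < m by rewrite (leq_trans idx) // -cardE.
  by exists (Ordinal idm); rewrite ffunE /= (nth_map z) // nth_index // mem_enum.
rewrite ffunE; have [lt|ge] := ltnP i (size (enum J)); last first.
  by rewrite nth_default // size_map.
by rewrite (nth_map z) // => -[->]; rewrite -mem_enum mem_nth.
Qed.

End Shattering.

(** * Numerical estimates *)

(** Bernoulli's inequality in integer form: [l] slicing steps at least halve the bound on the number
    of shattered sets. *)
Lemma double_expn_pred l : 0 < l -> 2 * l.-1 ^ l <= l ^ l.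
Proof.
case: l => // l _ /=.
have le : forall j, l ^ j.+1 + j.+1 * l ^ j <= l.+1 ^ j.+1.
  elim=> [|j IH]; first by rewrite expn1 expn0 muln1 expn1 addn1.
  rewrite [l.+1 ^ _]expnS; apply: leq_trans (leq_mul (leqnn l.+1) IH).
  rewrite !expnS; nia.
apply: leq_trans (le l).
rewrite mul2n -addnn leq_add2l expnS leq_mul2r; lia.
Qed.

(** From [L = 4] on, passing to [L + 1] at most doubles the cube; the factor 8 covers the small
    values. *)
Lemma cube_le_pow2 L : L ^ 3 <= 8 * 2 ^ L.
Proof.
have [L4|L4] := leqP L 4; first by do 5?[case: L L4 => [//|L] L4].
elim: L L4 => // L IH; rewrite ltnS leq_eqVlt => /predU1P[<-//|L4].
have := IH L4; rewrite expnS [2 ^ L.+1]expnS !expnS expn0; nia.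
Qed.

(** * Minimal subcovers of the joined cover *)

(** [xget] would return its default 0 if there were no minimum; the full list of indices is a
    subcover, so there is one. *)
Lemma NcoverP (X : Type) (C : seq (set X)) :
  (forall x, exists2 A, A \in C & A x) ->
  has_subcover_of_size C (Ncover C) /\
  (forall m, has_subcover_of_size C m -> Ncover C <= m).
Proof.
move=> covC; rewrite /Ncover; case: xgetP => [n -> //|noN].
have /asboolP ex : has_subcover_of_size C (size C).
  exists (iota 0 (size C)); split; first exact: size_iota.
  split=> [|x]; first by apply/allP => i; rewrite mem_iota.
  have [A AC Ax] := covC x; exists (index A C); last by rewrite nth_index.
  by rewrite mem_iota /= add0n index_mem.
have [n /asboolP nC nmin] := 
  ex_minnP (ex_intro (fun n => `[< has_subcover_of_size C n >]) _ ex).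
by case: (noN n); split => // m /asboolP /nmin.
Qed.

Section JoinedCover.
Variables (G X : Type) (act : G -> X -> X) (s : nat -> G).
Variables (l : nat) (U : 'I_l -> set X).
Hypothesis l_gt1 : 1 < l.
Hypothesis U_disj : forall i j, i != j -> U i `&` U j = set0.

(** The shift [z.+1] appears because the join runs over [1, ..., n] while ['I_n] starts at 0. *)
Let P n (z : 'I_n) (i : 'I_l) : set X := [set x | U i (act (s z.+1) x)].
Let avoid n (g : {ffun 'I_n -> 'I_l}) : set X := [set x | forall z, ~ P z (g z) x].
Let C n := seq_join act s [seq ~` U j | j <- enum 'I_l] n.

(** The starting index [m] is left free for the induction, as the tail of [iota m n.+1] starts at
    [m.+1]. *)
Lemma mem_foldr_cover_join m n (A : set X) :
  A \in foldr (fun i V => cover_join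
                 (cover_preimage (act (s i)) [seq ~` U j | j <- enum 'I_l]) V)
              [:: setT] (iota m n) <->
  exists g : nat -> 'I_l,
    A = [set x | forall i, m <= i < m + n -> ~ U (g i) (act (s i) x)].
Proof.
elim: n m A => [|n IH] m A /=.
  rewrite addn0; split=> [|[g ->]]; rewrite inE.
    move=> /eqP ->; exists (fun=> Ordinal (ltnW l_gt1)).
    by apply/seteqP; split => x //= _ i ; lia.
  by apply/eqP/seteqP; split => x //= _ i; lia.
split=> [/allpairsP[[B D] /= [/mapP[E /mapP[j _ ->] ->] /IH[g ->] ->]]|[g ->]].
  exists (fun i => if i == m then j else g i).
  apply/seteqP; split => x /= => [[xj xg] i imn|xg].
    have [->//|im] := eqVneq i m; apply: xg; lia.
  split=> [|i imn]; first by have := xg m; rewrite eqxx; apply; lia.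
  have := xg i; rewrite ifN; [apply; lia|lia].
apply/allpairsP.
exists (act (s m) @^-1` (~` U (g m)),
  [set x | forall i, m.+1 <= i < m.+1 + n -> ~ U (g i) (act (s i) x)]) => /=.
split.
- by apply/map_f/map_f; rewrite mem_enum.
- by apply/IH; exists g.
- apply/seteqP; split => x /= => [xg|[xm xg] i imn].
    split=> [|i imn]; apply: xg; lia.
  by have [->//|im] := eqVneq i m; apply: xg; lia.
Qed.

Lemma mem_seq_join n (A : set X) :
  A \in C n <-> exists g : {ffun 'I_n -> 'I_l}, A = avoid g.
Proof.
rewrite /C /seq_join; split=> [/mem_foldr_cover_join[g ->]|[g ->]].
  exists [ffun z : 'I_n => g z.+1]; apply/seteqP; split=> x /= xg.
    by move=> z; rewrite ffunE; apply: xg; rewrite /= add1n ltnS.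
  case=> // i imn; have := xg (Ordinal (imn : i < n)); by rewrite ffunE.
apply/mem_foldr_cover_join.
(* The predecessor undoes the shift; the values outside [1, ..., n] are arbitrary. *)
exists (fun i => if insub i.-1 is Some z then g z else Ordinal (ltnW l_gt1)).
apply/seteqP; split=> x /= xg => [[//|i] imn|z].
  have iin : i < n by rewrite add1n ltnS in imn.
  rewrite /= (insubT (fun i => i < n) iin) /=; exact: xg (Ordinal iin).
have := xg z.+1; rewrite add1n /= ltnS ltn_ord => /(_ isT).
by rewrite /= valK.
Qed.

Lemma seq_join_covers n x : exists2 A, A \in C n & A x.
Proof.
have /fin_all_exists[g gP] (z : 'I_n) : exists i, ~ P z i x.
  have [U0|nU0] := pselect (P z (Ordinal (ltnW l_gt1)) x).
    exists (Ordinal l_gt1) => U1.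
    have : (U (Ordinal (ltnW l_gt1)) `&` U (Ordinal l_gt1)) (act (s z.+1) x) by [].
    by rewrite U_disj.
  by exists (Ordinal (ltnW l_gt1)).
exists (avoid (finfun g)); first by apply/mem_seq_join; exists (finfun g).
by move=> z; rewrite ffunE.
Qed.

Lemma Ncover_seq_join_le n (gs : seq {ffun 'I_n -> 'I_l}) :
  (forall x, exists2 g, g \in gs & avoid g x) -> Ncover (C n) <= size gs.
Proof.
move=> cov; have [_ ->//] := NcoverP (@seq_join_covers n).
have gC (g : {ffun 'I_n -> 'I_l}) : avoid g \in C n by apply/mem_seq_join; exists g.
exists [seq index (avoid g) (C n) | g <- gs]; rewrite size_map; split=> //.
split=> [|x]; first by apply/allP => i /mapP[g _ ->]; rewrite index_mem.
have [g ggs gx] := cov x; exists (index (avoid g) (C n)); first exact: map_f.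
by rewrite nth_index.
Qed.

Lemma Ncover_seq_join_attained n : exists2 gs : seq {ffun 'I_n -> 'I_l},
  size gs = Ncover (C n) & forall x, exists2 g, g \in gs & avoid g x.
Proof.
have [[idx [<- [/allP idxC cov]]] _] := NcoverP (@seq_join_covers n).
have ex_h i : exists g : {ffun 'I_n -> 'I_l}, i \in idx -> nth set0 (C n) i = avoid g.
  have [/idxC iC|nidx] := boolP (i \in idx); last first.
    by exists [ffun=> Ordinal (ltnW l_gt1)].
  by have /mem_seq_join[g gE] := mem_nth set0 iC; exists g.
have [h hP] := choice ex_h; exists (map h idx); first by rewrite size_map.
move=> x; have [i ii ix] := cov x; exists (h i); first exact: map_f.
by rewrite -hP.
Qed.

(** Each [tau] is realised by a point in some member [avoid g] of a minimal subcover, so [tau j]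
    differs from [g (b j)] for all [j]. One [g] allows only [(l - 1) ^ p] of the [l ^ p]
    colourings. *)
Lemma Ncover_seq_join_lower n p (b : 'I_p -> 'I_n) :
  (forall tau : 'I_p -> 'I_l, exists x, forall j, P (b j) (tau j) x) ->
  l ^ p <= Ncover (C n) * l.-1 ^ p.
Proof.
move=> indep; have [gs <- cov] := Ncover_seq_join_attained n.
pose Q (g : {ffun 'I_n -> 'I_l}) : pred {ffun 'I_p -> 'I_l} :=
  family (fun j => predC1 (g (b j))).
have cardQ g : #|Q g| = l.-1 ^ p.
  rewrite card_family foldrE big_image /= (eq_bigr (fun=> l.-1)).
    by rewrite prod_nat_const card_ord.
  by move=> j _; rewrite cardC1 card_ord.
have card_has (hs : seq {ffun 'I_n -> 'I_l}) :
    #|[pred tau | has (Q ^~ tau) hs]| <= size hs * l.-1 ^ p.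
  elim: hs => [|g hs IH] /=; first by rewrite eq_card0.
  rewrite mulSn -{1}(cardQ g); apply: leq_trans (leq_add (leqnn _) IH).
  rewrite -cardUI.
  apply: leq_trans _ (leq_addr _ _).
  by rewrite (eq_card (_ : _ =i [predU Q g & [pred tau | has (Q^~ tau) hs]])).
apply: leq_trans (card_has gs).
rewrite -[X in X ^ _ <= _]card_ord -[X in _ ^ X <= _]card_ord -card_ffun.
apply/subset_leq_card/fintype.subsetP => tau _.
have [x xP] := indep tau; have [g ggs gx] := cov x.
apply/hasP; exists g => //; apply/familyP => j; apply/eqP => tg.
by apply: (gx (b j)); rewrite -tg.
Qed.

(** Fewer than [2 ^ ((m + 1) L)] sets are shattered, where [n + 1 < 2 ^ L]. As [l] slicing steps
    halve this bound, [l (m + 1) L] steps exhaust it and leave at most [(n + 1) ^ (l (m + 1) L)]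
    functions. *)
Lemma Ncover_seq_join_upper n m :
  (forall J, shatters (@P n) setT J -> #|J| <= m) ->
  Ncover (C n) <= 2 ^ (l * m.+1 * (trunc_log 2 n.+1).+1 ^ 2).
Proof.
move=> shm; set L := (trunc_log 2 n.+1).+1.
have nL : n.+1 < 2 ^ L by exact: trunc_log_ltn.
have Pd : forall z i j x, @P n z i x -> P z j x -> i = j.
  move=> z i j x xi xj; apply/eqP/negP => /negP ij.
  have : (U i `&` U j) (act (s z.+1) x) by [].
  by rewrite U_disj.
have [|gs szgs cov] :=
  @avoiding_functions _ _ _ (@P n) l_gt1 Pd setT (l * (m.+1 * L)) => //.
  rewrite !(expnM _ l).
  apply: leq_trans (_ : (2 * l.-1 ^ l) ^ (m.+1 * L) <= _); last first.
    by rewrite leq_exp2r ?double_expn_pred // ltnW.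
  rewrite expnMn ltn_pmul2r; last by rewrite !expn_gt0; lia.
  apply: leq_ltn_trans (nshattered_le shm) _.
  rewrite card_ord mulnC expnM.
  (* The exponent [m.+1] in place of [m] keeps the bound strict for [m = 0]. *)
  apply: leq_ltn_trans (_ : n.+1 ^ m.+1 < _); first by rewrite leq_pexp2l.
  by rewrite ltn_exp2r.
apply: leq_trans (@Ncover_seq_join_le n gs _) _.
  by move=> x; have [g ggs gP] := cov x I; exists g.
apply: leq_trans szgs _; rewrite card_ord.
apply: leq_trans (_ : (2 ^ L) ^ (l * (m.+1 * L)) <= _).
  by rewrite leq_exp2r ?(ltnW nL) // muln_gt0; lia.
rewrite -expnM leq_exp2l // expnS expn1; lia.
Qed.

End JoinedCover.

(** * Bounds on upper limits *)

Section Limsup.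
Variable R : realType.
Local Open Scope ereal_scope.

Lemma limn_esup_le_near (u : nat -> \bar R) (c : \bar R) (N : nat) :
  (forall n, (N <= n)%N -> u n <= c) -> limn_esup u <= c.
Proof.
move=> uc; rewrite /limn_esup /limf_esup.
apply: (@le_trans _ _ (ereal_sup [set u n | n in [set n | (N <= n)%N]])).
  apply: ereal_inf_lbound; exists [set n | (N <= n)%N] => //.
  exact: nbhs_infty_ge.
by apply: ge_ereal_sup => _ [n /= Nn <-]; exact: uc.
Qed.

Lemma limn_esup_ge_frequently (u : nat -> \bar R) (c : \bar R) :
  (forall N, exists2 n, (N <= n)%N & c <= u n) -> c <= limn_esup u.
Proof.
move=> uc; rewrite /limn_esup /limf_esup.
apply: le_ereal_inf_tmp => _ [A [N _ NA] <-].
have [n Nn cn] := uc N; apply: le_trans cn _.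
by apply: ereal_sup_ubound; exists n => //; exact: NA.
Qed.

End Limsup.

(** * The distinct points of a tuple and their neighbourhoods *)

(** Finitely many Hausdorff separations are intersected; regularity of the compact space then gives
    closed neighbourhoods inside. *)
Lemma disjoint_closed_nbhs (X : topologicalType) (l : nat) (y : 'I_l -> X)
    (W : 'I_l -> set X) :
  compact [set: X] -> hausdorff_space X -> injective y ->
  (forall j, nbhs (y j) (W j)) ->
  exists U : 'I_l -> set X,
    [/\ forall j, closed (U j) /\ nbhs (y j) (U j),
        forall i j, i != j -> U i `&` U j = set0 &
        forall j, U j `<=` W j].
Proof.
move=> cX hX injy yW.
have sep (ij : 'I_l * 'I_l) : exists AB : set X * set X,
    [/\ nbhs (y ij.1) AB.1, nbhs (y ij.2) AB.2 &
        ij.1 != ij.2 -> AB.1 `&` AB.2 = set0].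
  case: ij => i j /=; have [->|ij] := eqVneq i j.
    by exists (setT, setT); split => //; exact: filterT.
  have yij : y i != y j by apply: contra_neq ij => /injy.
  move: hX; rewrite open_hausdorff => /(_ _ _ yij)[[A B] /= [yA yB] [oA oB /eqP AB]].
  exists (A, B); split => //; apply: open_nbhs_nbhs; split => //; exact/set_mem.
have [AB ABP] := choice sep.
(* [y i] is the first point for the pair [(i, j)] and the second for [(j, i)], hence the two
   conditions. *)
pose O i := [set x | W i x /\ forall j, (AB (i, j)).1 x /\ (AB (j, i)).2 x].
have yO i : nbhs (y i) (O i).
  apply: filterI; first exact: yW.
  apply: (@filter_forall _ _ _ (nbhs (y i))) => j.
  apply: filterI; first by have [] := ABP (i, j).
  by have [] := ABP (j, i).
have ex_E i : exists E, nbhs (y i) E /\ closure E `<=` O i.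
  have [E yE EO] := compact_regular hX cX (@filterT _ (nbhs (y i)) _) (yO i).
  by exists E.
have [E EP] := choice ex_E; exists (fun i => closure (E i)); split=> [j|i j ij|j x].
- split; first exact: closed_closure.
  by apply: filterS (EP j).1; exact: subset_closure.
- rewrite -subset0 => x [/(proj2 (EP i))[_ /(_ j)[xA _]] /(proj2 (EP j))[_ /(_ i)[_ xB]]].
  by have [_ _ /(_ ij) <-] := ABP (i, j).
- by move=> /(proj2 (EP j))[].
Qed.

Lemma distinct_points (X : topologicalType) (k : nat) (x : 'I_k -> X) :
  exists l, exists2 y : 'I_l -> X, injective y & range y = range x.
Proof.
pose r := undup (map x (enum 'I_k)).
exists (size r), (tnth (in_tuple r)).
  by apply/tuple_uniqP; rewrite undup_uniq.
apply/seteqP; split=> [_ [j _ <-]|_ [i _ <-]].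
  have := mem_tnth j (in_tuple r); rewrite mem_undup => /mapP[i _ ->].
  by exists i.
have : x i \in in_tuple r by rewrite mem_undup map_f // mem_enum.
by move=> /tnthP[j ->]; exists j.
Qed.

Lemma off_diagonal_gt1 (X : Type) (k l : nat) (x : 'I_k -> X) (y : 'I_l -> X) :
  off_diagonal x -> range y = range x -> 1 < l.
Proof.
move=> offx ryx; rewrite ltnNge; apply/negP => l1; apply: offx => i j.
have [i' _ <-] : range y (x i) by rewrite ryx; exists i.
have [j' _ <-] : range y (x j) by rewrite ryx; exists j.
congr y; apply/ord_inj; have := ltn_ord i'; have := ltn_ord j'; lia.
Qed.

Local Open Scope ring_scope.

(** * Positive entropy and independence for disjoint sets *)

Section Entropy.
Variables (R : realType) (G X : Type) (act : G -> X -> X).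
Variables (l : nat) (U : 'I_l -> set X).
Hypothesis l_gt1 : (1 < l)%N.
Hypothesis U_disj : forall i j, i != j -> U i `&` U j = set0.

Let C s n := seq_join act s [seq ~` U j | j <- enum 'I_l] n.

(** The sequence cannot repeat a value on a shattered set: giving the two indices different colours
    would place one point in two disjoint sets. *)
Lemma shatters_independence (s : nat -> G) n m (J : {set 'I_n}) :
  shatters (fun (z : 'I_n) i => [set x | U i (act (s z.+1) x)]) setT J ->
  (m <= #|J|)%N ->
  exists K : set G, finite_set K /\ independence_set act U K /\
    exists f : 'I_m -> G, injective f /\ range f `<=` K.
Proof.
move=> /asboolP sh mJ.
pose K := [set s z.+1 | z in [set z : 'I_n | z \in J]].
exists K; split; first exact: finite_image.
split=> [I _ _ IK sigma|].
  have [x _ xP] := sh (fun z => sigma (s z.+1)).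
  by exists x => t It; have [z zJ <-] := IK _ It; exact: xP.
exists (fun j => s (enum_val (widen_ord mJ j)).+1); split; last first.
  by move=> _ [j _ <-]; exists (enum_val (widen_ord mJ j)) => //=; exact: enum_valP.
move=> j1 j2 eqs; apply/eqP/negP => /negP j12.
have ne : enum_val (widen_ord mJ j1) != enum_val (widen_ord mJ j2).
  by apply: contra_neq j12 => /enum_val_inj/(congr1 val)/= /ord_inj.
have [x _ xP] := sh (fun z => if z == enum_val (widen_ord mJ j1)
                      then Ordinal (ltnW l_gt1) else Ordinal l_gt1).
have := xP _ (enum_valP (widen_ord mJ j1)); rewrite eqxx /= eqs => x0.
have := xP _ (enum_valP (widen_ord mJ j2)); rewrite eq_sym (negbTE ne) /= => x1.
have : (U (Ordinal (ltnW l_gt1)) `&` U (Ordinal l_gt1))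
  (act (s (enum_val (widen_ord mJ j2)).+1) x) by [].
by rewrite U_disj.
Qed.

(** Since [L ^ 3 <= 8 * 2 ^ L <= 32 n], the bound [c L ^ 2 ln 2 / n] on the rate, multiplied by [L],
    is at most [32 c ln 2]. *)
Lemma entropy_rate_le (N n c L : nat) (eps : R) : (0 < n)%N ->
  (N <= 2 ^ (c * L ^ 2))%N -> (2 ^ L <= 4 * n)%N -> 0 < eps ->
  32 * c%:R * ln 2 <= eps * L%:R -> ln (N%:R : R) / n%:R <= eps.
Proof.
move=> n0 Nle Ln eps0 cL; rewrite ler_pdivrMr ?ltr0n //.
have ln2 : 0 <= ln (2 : R) by rewrite ln_ge0 // ler1n.
apply: (@le_trans _ _ (c%:R * L%:R ^+ 2 * ln 2)).
  (* The case [N = 0] is separate: there [ln] takes the value 0. *)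
  case: N Nle => [|N] Nle; first by rewrite ln0 // mulr_ge0 // mulr_ge0 // exprn_ge0.
  apply: le_trans (_ : ln ((2 ^ (c * L ^ 2))%:R : R) <= _).
    by rewrite ler_ln ?posrE ?ltr0n ?expn_gt0 // ler_nat.
  by rewrite natrX lnXn ?ltr0n // -[X in X <= _]mulr_natl natrM natrX.
rewrite -(ler_pM2l (_ : 0 < 32)) ?ltr0n //.
have L3 : (L%:R : R) ^+ 3 <= 32 * n%:R.
  rewrite -natrX -natrM ler_nat; apply: leq_trans (cube_le_pow2 L) _; lia.
apply: le_trans (_ : eps * L%:R ^+ 3 <= _).
  rewrite (_ : 32 * _ = (32 * c%:R * ln 2) * L%:R ^+ 2); last by ring.
  by rewrite [_ ^+ 3]exprS [leRHS]mulrA ler_wpM2r // exprn_ge0.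
by rewrite [leRHS]mulrCA ler_wpM2l // ltW.
Qed.

(** Without independence sets of size [m], the shattered sets have size at most [m] for every [n],
    and the rate falls below each [eps]. *)
Lemma htop_pos_independence s :
  (0 < htop_seq R act [seq ~` U j | j <- enum 'I_l] s)%E ->
  arb_large_independence act U.
Proof.
move=> hpos m; apply: contrapT => noK; move: hpos; apply/negP; rewrite -leNgt.
have shm n (J : {set 'I_n}) :
    shatters (fun (z : 'I_n) i => [set x | U i (act (s z.+1) x)]) setT J ->
    (#|J| <= m)%N.
  move=> sh; rewrite leqNgt; apply/negP => /ltnW mJ; apply: noK.
  exact: shatters_independence sh mJ.
apply/lee_addgt0Pr => eps eps0; rewrite add0e.
pose c := (l * m.+1)%N.
(* For [n >= 2 ^ K] the logarithm [L] is at least [K], which exceeds [32 c ln 2 / eps]. *)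
pose K := Num.bound (32 * c%:R * ln 2 / eps : R).
apply: (@limn_esup_le_near _ _ _ (2 ^ K)%N) => n Kn; rewrite lee_fin.
have n0 : (0 < n)%N by rewrite (leq_trans _ Kn) // expn_gt0.
apply: (@entropy_rate_le _ n c (trunc_log 2 n.+1).+1) => //.
- exact: (Ncover_seq_join_upper l_gt1 U_disj (@shm n)).
- rewrite expnS; have := @trunc_logP 2 n.+1 isT isT; lia.
rewrite [leRHS]mulrC -ler_pdivrMr //.
apply: le_trans (ltW (archi_boundP _)) _.
  by rewrite divr_ge0 ?(ltW eps0) // mulr_ge0 // ?mulr_ge0 // ln_ge0 // ler1n.
rewrite ler_nat leqW // trunc_log_max //; exact: leq_trans Kn _.
Qed.

(* The sequence concatenates independent blocks of lengths [1, 2, 4, ...], so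
   that at the end of a block at least half of the sequence is independent. *)
Lemma independence_htop_pos : arb_large_independence act U ->
  exists s, (0 < htop_seq R act [seq ~` U j | j <- enum 'I_l] s)%E.
Proof.
move=> indep.
have block m : exists f : nat -> G, forall tau : 'I_(2 ^ m) -> 'I_l,
    exists x, forall j : 'I_(2 ^ m), U (tau j) (act (f j) x).
  have [J [_ [Jind [f [finj fJ]]]]] := indep (2 ^ m)%N.
  have m0 : (0 < 2 ^ m)%N by rewrite expn_gt0.
  exists (fun j => f (insubd (Ordinal m0) j)) => tau.
  (* As [f] is injective, [tau] transfers to a colouring of its range; elsewhere a default colour is
     used. *)
  pose sigma g := if [pick j | `[< f j = g >]] is Some j then tau j
                  else Ordinal (ltnW l_gt1).
  have [|||x xP] := Jind (range f) _ _ _ sigma => //.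
  - exact: finite_image.
  - by exists (f (Ordinal m0)), (Ordinal m0).
  exists x => j; rewrite valKd.
  have := xP (f j) (ex_intro2 _ _ j I erefl); rewrite /sigma.
  by case: pickP => [i /asboolP /finj -> //|/(_ j)/asboolP].
have [f fP] := choice block.
(* Block [m] occupies the indices from [2 ^ m] to [2 ^ m.+1 - 1]. *)
pose s i := f (trunc_log 2 i) (i - 2 ^ trunc_log 2 i)%N; exists s.
pose r : R := l%:R / l.-1%:R.
have r1 : 1 < r by rewrite ltr_pdivlMr ?ltr0n ?mul1r ?ltr_nat; lia.
(* At the end [n] of block [N] the rate is at least [2 ^ N ln r / n], and [n < 2 * 2 ^ N]. *)
apply: (@lt_le_trans _ _ (ln r / 2)%:E).
  by rewrite lte_fin divr_gt0 // ln_gt0.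
apply: limn_esup_ge_frequently => N; pose n := (2 ^ N.+1).-1.
have NE : (2 ^ N.+1 = 2 * 2 ^ N)%N by rewrite expnS.
have Npos : (0 < 2 ^ N)%N by rewrite expn_gt0.
have Nlt : (N < 2 ^ N)%N by exact: ltn_expl.
have nE : (n.+1 = 2 * 2 ^ N)%N by rewrite /n -NE prednK // expn_gt0.
exists n; first by lia.
(* Sequence index [2 ^ N + j] sits one position lower in ['I_n]. *)
have bP (j : 'I_(2 ^ N)) : ((2 ^ N + j).-1 < n)%N.
  by have := ltn_ord j; lia.
have lower : (l ^ (2 ^ N) <= Ncover (C s n) * l.-1 ^ (2 ^ N))%N.
  apply: (@Ncover_seq_join_lower _ _ _ _ _ _ l_gt1 U_disj n _ (fun j => Ordinal (bP j))).
  move=> tau; have [x xP] := fP N tau; exists x => j /=.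
  rewrite prednK; last by lia.
  rewrite /s (@trunc_log_eq 2 N) ?addKn //; last by have := ltn_ord j; lia.
rewrite lee_fin ler_pdivlMr ?ltr0n; last by lia.
have pow_pos : 0 < (l.-1%:R : R) ^+ (2 ^ N)%N by rewrite exprn_gt0 // ltr0n; lia.
have rN : r ^+ (2 ^ N)%N <= (Ncover (C s n))%:R.
  by rewrite expr_div_n ler_pdivrMr // -!natrX -natrM ler_nat.
have r0 : 0 < r by exact: lt_trans r1.
apply: le_trans (_ : ln (r ^+ (2 ^ N)%N) <= _); last first.
  rewrite ler_ln ?posrE ?exprn_gt0 //.
  by apply: lt_le_trans rN; rewrite exprn_gt0.
rewrite lnXn // -[leRHS]mulr_natr [leLHS]mulrAC -[leLHS]mulrA ler_wpM2l //.
  by rewrite ln_ge0 // ltW.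
by rewrite ler_pdivrMr ?ltr0n // -natrM ler_nat; lia.
Qed.

End Entropy.

(** * From distinct points to tuples with repetitions, and back *)

Lemma sequence_entropy_IN (R : realType) (G : Type) (X : topologicalType)
    (act : G -> X -> X) (k : nat) (x : 'I_k -> X) :
  compact [set: X] -> hausdorff_space X ->
  sequence_entropy_tuple R act x -> IN_tuple act x.
Proof.
move=> cX hX [offx seqx] V xV.
have [l [y yinj ryx]] := distinct_points x.
have l_gt1 := off_diagonal_gt1 offx ryx.
have [|U [Ucn Udisj UW]] := disjoint_closed_nbhs cX hX yinj
  (* Entries equal to [y j] must share one neighbourhood, so their sets [V i] are intersected. *)
  (W := fun j => [set z | forall i, x i = y j -> V i z]).
  move=> j; apply: (@filter_forall _ _ (fun i z => x i = y j -> V i z) (nbhs (y j))) => i.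
  have [xy|nxy] := pselect (x i = y j).
    by rewrite -xy; apply: filterS (xV i) => z.
  by apply: nearW => z.
have [s /(htop_pos_independence l_gt1 Udisj) indU] := seqx l y yinj ryx U Ucn Udisj.
have ex_pi i : exists j, x i = y j.
  have [j _ yj] : range y (x i) by rewrite ryx; exists i.
  by exists j.
have [pi piP] := choice ex_pi.
move=> n; have [J [Jfin [Jind Jn]]] := indU n.
exists J; split => //; split => // I Ifin I0 IJ sigma.
have [z zP] := Jind I Ifin I0 IJ (pi \o sigma).
by exists z => t /zP /UW; exact.
Qed.

(** Colourings by distinct points lift to colourings by entries along a section [rho] of [pi], so an
    independence set for [U \o pi] is one for [U]. *)
Lemma IN_sequence_entropy (R : realType) (G : Type) (X : topologicalType)
    (act : G -> X -> X) (k : nat) (x : 'I_k -> X) :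
  off_diagonal x -> IN_tuple act x -> sequence_entropy_tuple R act x.
Proof.
move=> offx INx; split=> // l y yinj ryx U Ucn Udisj.
apply: independence_htop_pos => //; first exact: off_diagonal_gt1 ryx.
have ex_pi i : exists j, x i = y j.
  have [j _ yj] : range y (x i) by rewrite ryx; exists i.
  by exists j.
have [pi piP] := choice ex_pi.
have ex_rho j : exists i, x i = y j.
  have [i _ xi] : range x (y j) by rewrite -ryx; exists j.
  by exists i.
have [rho rhoP] := choice ex_rho.
have rhoK j : pi (rho j) = j by apply: yinj; rewrite -piP.
move=> n; have [|J [Jfin [Jind Jn]]] := INx (U \o pi) _ n.
  by move=> i; rewrite piP; case: (Ucn (pi i)).
exists J; split => //; split => // I Ifin I0 IJ sigma.
have [z zP] := Jind I Ifin I0 IJ (rho \o sigma).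
by exists z => t /zP /=; rewrite rhoK.
Qed.

Theorem theorem5p9 (R : realType) (G : topologicalType) (mul : G -> G -> G) (e : G)
  (X : topologicalType) (act : G -> X -> X)
  (mulA : forall a b c, mul a (mul b c) = mul (mul a b) c)
  (mul1g : forall a, mul e a = a) (mulg1 : forall a, mul a e = a)
  (mul_cont : continuous (fun p : G * G => mul p.1 p.2))
  (act1 : forall x, act e x = x)
  (actM : forall s t x, act (mul s t) x = act s (act t x))
  (act_cont : continuous (fun p : G * X => act p.1 p.2))
  (act_cont_s : forall s, continuous (act s))
  (act_surj : forall s (y : X), exists z, act s z = y)
  (X_compact : compact [set: X]) (X_hausdorff : hausdorff_space X)
  (k : nat) (hk : (2 <= k)%N) (x : 'I_k -> X) (hx : off_diagonal x) :
  sequence_entropy_tuple R act x <-> IN_tuple act x.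
Proof.
split; first exact: sequence_entropy_IN.
exact: IN_sequence_entropy.
Qed.
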